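(* Let $\Omega=[-1,4]$, $T=5$, $Y=[1/2,3]$. For $(t,y)\in[0,T]\times Y$ let $u_{y,t}$ be the probability measure on $\Omega$ with Lebesgue density $\rho_y(t,\cdot)$, where $\rho_y$ is the entropy solution of the inviscid Burgers' equation $$\partial_t\rho_y+\tfrac12\partial_x(\rho_y^2)=0\quad\text{on }[0,T]\times\Omega,\qquad \rho_y(0,x)=\begin{cases}0,&-1\le x<0,\\ y,&0\le x<\tfrac1y,\\ 0,&\tfrac1y\le x\le4,\end{cases}$$ with periodic boundary conditions on $\Omega$. Let $w$ be a probability measure on $\Omega$ with finite second moment, and let $$\mathcal{T}=\{\mathrm{icdf}_{u_{y,t}}-\mathrm{icdf}_w : (t,y)\in[0,T]\times Y\}\subset L^2([0,1]).$$ Then there exists a constant $C>0$ such that for all integers $n\ge1$, $$d_n(\mathcal{T},L^2([0,1]))\le C\,n^{-21/10}.$$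
   Context: For a probability measure $u$ on $\Omega=[x_{\min},x_{\max}]$ with finite second moment, $\mathrm{cdf}_u(x)=\int_{x_{\min}}^x du$ and $\mathrm{icdf}_u(s)=\inf\{x\in\Omega:\mathrm{cdf}_u(x)>s\}$ for $s\in[0,1]$, regarded as an element of $L^2([0,1])$. Explicitly, the entropy solution is as follows. For $0<t<2/y^2$: $\rho_y(t,x)=0$ for $-1\le x<0$; $\rho_y(t,x)=x/t$ for $0\le x<yt$; $\rho_y(t,x)=y$ for $yt\le x\le \frac1y+\frac{yt}{2}$; $\rho_y(t,x)=0$ for $\frac1y+\frac{yt}{2}<x\le4$. For $t\ge 2/y^2$: $\rho_y(t,x)=0$ for $-1\le x<0$; $\rho_y(t,x)=x/t$ for $0\le x\le\sqrt{2t}$; $\rho_y(t,x)=0$ for $x>\sqrt{2t}$. Kolmogorov width: for a subset $\mathcal{S}$ of a Hilbert space $V$ and an integer $n\ge1$, $d_n(\mathcal{S},V)=\inf_{V_n}\sup_{v\in\mathcal{S}}\inf_{g\in V_n}\|v-g\|_V$, where the infimum runs over linear subspaces $V_n\subset V$ of dimension $n$. *)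

(* Defs.v *)
From HB Require Import structures.
From mathcomp Require Import all_boot all_order all_algebra.
From mathcomp Require Import all_classical all_reals all_analysis.
From mathcomp Require Import measurable_realfun.
From mathcomp Require Import ring lra.

Set Implicit Arguments.
Unset Strict Implicit.
Unset Printing Implicit Defensive.

Import Order.TTheory GRing.Theory Num.Theory.
Import numFieldNormedType.Exports.

Local Open Scope classical_set_scope.
Local Open Scope ring_scope.

Section kolmogorov_width.
Context {R : realType} {V : lmodType R}.

(* [N] is meant to be a seminorm on [V], and [V] stands for the normed space
   V / {N = 0}: linear independence is therefore required modulo the vectors
   of seminorm zero. With [V] the square-integrable functions and [N] the
   L^2-norm, these are the n-dimensional subspaces of L^2. *)
Definition linear_subspace_of_dim (N : V -> \bar R) (n : nat) (W : set V) :=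
  exists e : 'I_n -> V,
    (forall c : 'I_n -> R, N (\sum_(i < n) c i *: e i) = 0%E ->
       forall i, c i = 0) /\
    W = [set v | exists c : 'I_n -> R, v = \sum_(i < n) c i *: e i].

Definition kolmogorov_width (N : V -> \bar R) (S : set V) (n : nat) : \bar R :=
  ereal_inf [set ereal_sup [set ereal_inf [set N (v - g) | g in W] | v in S]
            | W in linear_subspace_of_dim N n].

End kolmogorov_width.

Section L2.
Context {R : realType}.

Lemma one_le_two : (1 <= (2%:R : R)%:E)%E.
Proof. by rewrite lee_fin ler1n. Qed.

Definition lebesgue01 : {measure set (measurableTypeR R) -> \bar R} :=
  mrestr (@lebesgue_measure R) (measurable_itv `[0, 1]).

(* Representatives of the elements of L^2([0,1]); their values outside [0,1]
   are irrelevant. *)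
Definition L2_01 := LfunType lebesgue01 one_le_two.

Definition L2_norm (f : L2_01) : \bar R := 'N[lebesgue01]_(2%:R%:E)[EFin \o f].

End L2.
Arguments L2_01 : clear implicits.

Section icdf.
Context {R : realType} (xmin xmax : R).
Variable u : probability (measurableTypeR R) R.

Definition cdf_from (x : R) : \bar R := u `[xmin, x]%classic.

(* [inf set0 = 0] is used where no x qualifies, which happens at s = 1. *)
Definition icdf (s : R) : R :=
  inf [set x | x \in `[xmin, xmax] /\ (s%:E < cdf_from x)%E].

Let le_cdf_from x y : x <= y -> (cdf_from x <= cdf_from y)%E.
Proof.
move=> xy; apply: le_measure; rewrite ?inE//=; try exact: measurable_itv.
exact: subitvPr.
Qed.

Let A s := [set x | x \in `[xmin, xmax] /\ (s%:E < cdf_from x)%E].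

Let A_lb s : lbound (A s) xmin.
Proof. by move=> x [] /[!in_itv]/= /andP[]. Qed.

Let A_max s : A s !=set0 -> A s xmax.
Proof.
move=> [x [/[!in_itv]/= /andP[ax xb] sx]]; split.
  by rewrite in_itv/= lexx (le_trans ax).
exact: lt_le_trans (le_cdf_from xb).
Qed.

Let icdf_le s : A s !=set0 -> xmin <= icdf s <= xmax.
Proof.
move=> A0; apply/andP; split; first by apply: lb_le_inf => //; exact: A_lb.
by apply: ge_inf; [exists xmin; exact: A_lb|exact: A_max].
Qed.

Lemma icdf_bounded s : `|icdf s| <= `|xmin| + `|xmax|.
Proof.
have [A0|/nonemptyPn A0] := pselect (A s !=set0); last first.
  by rewrite /icdf -/(A s) A0 inf0 normr0 addr_ge0.
have /andP[ai ib] := icdf_le A0.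
rewrite ler_norml; apply/andP; split.
  by rewrite (le_trans _ ai)// lerNl (le_trans (ler_norm _))// normrN lerDl.
by rewrite (le_trans ib)// (le_trans (ler_norm _))// lerDr.
Qed.

Lemma measurable_icdf : measurable_fun [set: measurableTypeR R] (icdf : _ -> R).
Proof.
pose b s := ((s%:E < cdf_from xmax)%E && (xmin <= xmax)).
have AE s : A s !=set0 <-> b s.
  rewrite /b; split=> [/A_max[/[!in_itv]/= /andP[-> _] ->]//|/andP[sb ab]].
  by exists xmax; split=> //; rewrite in_itv/= ab lexx.
pose g s := if b s then icdf s else xmax.
have -> : icdf = (fun s => if b s then g s else 0) :> (R -> R).
  apply/funext => s; rewrite /g; case: (boolP (b s)) => // /negP nb.
  have As0 : A s = set0 by apply/(nonemptyPn (A s)) => /AE.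
  by rewrite /icdf -/(A s) As0 inf0.
apply: measurable_fun_ifT => //.
- apply: measurable_and => //.
  by apply: measurable_fun_lte => //; exact: measurable_EFin.
- apply: nondecreasing_measurable => // s t st; rewrite /g.
  case: ifPn => [/AE bs|bs]; case: ifPn => [/AE bt|bt] //.
  + apply: lb_le_inf => // x [xI tx]; apply: ge_inf.
      by exists xmin; exact: A_lb.
    by split => //; rewrite (le_lt_trans _ tx)// lee_fin.
  + by have /andP[] := icdf_le bs.
  + move: bt => /AE/andP[tb ab]; move: bs.
    by rewrite /b ab andbT (le_lt_trans _ tb)// lee_fin.
Qed.

Lemma icdf_Lfun : icdf \in Lfun (@lebesgue01 R) 2%:R%:E.
Proof.
rewrite inE; apply/andP; split; rewrite inE/=; first exact: measurable_icdf.
pose M := `|xmin| + `|xmax|.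
rewrite /finite_norm unlock poweR_lty//.
apply: (@le_lt_trans _ _ (\int[lebesgue01]_x (M `^ 2%:R)%:E)%E).
  apply: ge0_le_integral => //.
  - by move=> x _; exact: poweR_ge0.
  - apply: (measurableT_comp (measurable_poweR _)) => //.
    by do 2 apply: measurableT_comp => //; exact: measurable_icdf.
  - move=> x _; rewrite /= lee_fin ge0_ler_powR ?nnegrE ?addr_ge0//.
    exact: icdf_bounded.
rewrite integral_cst//= /lebesgue01 /mrestr setTI lebesgue_measure_itv/=.
by rewrite lte_fin ltr01 -EFinD subr0 mule1 ltry.
Qed.

Definition icdf_L2 : L2_01 R := Lfun_Sub one_le_two icdf_Lfun.

End icdf.

Section burgers.
Context {R : realType}.
Implicit Types t y x : R.

(* The entropy solution of the inviscid Burgers equation on [-1,4] with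
   periodic boundary conditions and initial datum y on [0,1/y[ and 0 elsewhere:
   a rarefaction wave issued from 0 and a shock issued from 1/y, which meet at
   t = 2/y^2. The formula is meant for 0 <= t <= 5 and 1/2 <= y <= 3; the wave
   does not reach the right end of the domain in this range. *)
Definition burgers y t x : R :=
  if t == 0 then
    if 0 <= x < y^-1 then y else 0
  else if t < 2 / y ^+ 2 then
    if x < 0 then 0
    else if x < y * t then x / t
    else if x <= y^-1 + y * t / 2 then y
    else 0
  else
    if x < 0 then 0
    else if x <= Num.sqrt (2 * t) then x / t
    else 0.

Lemma burgers_ge0 y t x : 0 <= t -> 0 <= y -> 0 <= burgers y t x.
Proof.
move=> t0 y0; rewrite /burgers.
case: ifPn => _; first by case: ifPn.
by case: ifPn => _; do ! (case: ifPn => //); rewrite -leNgt;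
   move=> *; rewrite divr_ge0.
Qed.

Lemma measurable_burgers y t : measurable_fun [set: R] (burgers y t).
Proof.
rewrite /burgers; case: (t == 0).
  apply: measurable_fun_ifT => //.
  by apply: measurable_and => //;
    [exact: measurable_fun_ler|exact: measurable_fun_ltr].
have mdiv : measurable_fun [set: R] (fun x => x / t).
  exact: measurable_funM.
case: (t < _).
  do 3 (apply: measurable_fun_ifT => //;
    try by [exact: measurable_fun_ltr|exact: measurable_fun_ler]).
by do 2 (apply: measurable_fun_ifT => //;
  try by [exact: measurable_fun_ltr|exact: measurable_fun_ler]).
Qed.

Local Notation mu := (@lebesgue_measure R).

Let integral_ramp (t c : R) : 0 < t -> 0 < c ->
  (\int[mu]_(x in `[0%R, c]) (x / t)%:E)%E = (c ^+ 2 / (2 * t))%:E.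
Proof.
move=> t0 c0.
have dF x : is_derive x 1 (fun z : R => z ^+ 2 / (2 * t)) (x / t).
  apply: is_derive_eq.
  rewrite scaler0 add0r /GRing.scale/= mulr1.
  by field; rewrite gt_eqF.
rewrite (@continuous_FTC2 _ (fun x : R => x / t)
  (fun z : R => z ^+ 2 / (2 * t)) 0 c c0).
- by rewrite -EFinB expr0n/= mul0r subr0.
- apply: continuous_subspaceT => x.
  by apply: cvgM; [exact: cvg_id|exact: cvg_cst].
- have cF : continuous (fun z : R => z ^+ 2 / (2 * t)).
    by move=> x; apply/differentiable_continuous/derivable1_diffP; have [] := dF x.
  split.
  + by move=> x _; have [] := dF x.
  + exact/cvg_at_right_filter/cF.
  + exact/cvg_at_left_filter/cF.
- by move=> x _; rewrite derive1E; have [] := dF x.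
Qed.

Let integral_burgers_restrict y t (A : set R) : A `<=` `[-1, 4] ->
  (forall x, ~ A x -> burgers y t x = 0) ->
  (\int[mu]_(x in `[(-1)%R, 4%R]) (burgers y t x)%:E =
   \int[mu]_(x in A) (burgers y t x)%:E)%E.
Proof.
move=> sA A0; rewrite integral_mkcond [RHS]integral_mkcond.
apply: eq_integral => x _; rewrite /patch.
case: ifPn => xI; case: ifPn => // xA.
  by move: xA; rewrite notin_setE => /A0 ->.
by move: xI; rewrite notin_setE => /(_ (sA _ (set_mem xA))).
Qed.

Lemma integral_burgers y t : 0 <= t <= 5 -> 1 / 2 <= y <= 3 ->
  (\int[mu]_(x in `[(-1)%R, 4%R]) (burgers y t x)%:E = 1)%E.
Proof.
move=> /andP[t0 t5] /andP[yl yu].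
have y0 : 0 < y by lra.
have yi0 : 0 < y^-1 by rewrite invr_gt0.
have yi2 : y^-1 <= 2 by rewrite invf_ple ?posrE//; lra.
have yy : y * y^-1 = 1 by rewrite mulfV// gt_eqF.
have [te|tn] := eqVneq t 0.
  rewrite (@integral_burgers_restrict _ _ `[0, y^-1[%classic); last 2 first.
  - by move=> x/=; rewrite !in_itv/= => /andP[x0 x1]; apply/andP; split; lra.
  - by move=> x/=; rewrite in_itv/= /burgers te eqxx => /negP/negbTE ->.
  rewrite (eq_integral (cst y%:E)); last first.
    by move=> x; rewrite inE/= in_itv/= /burgers te eqxx => ->.
  rewrite integral_cst//= lebesgue_measure_itv/= lte_fin yi0.
  by rewrite -EFinD subr0 -EFinM yy.
have {tn}t0 : 0 < t by rewrite lt_neqAle eq_sym tn.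
have tn : (t == 0) = false by rewrite gt_eqF.
have [ty|ty] := ltP t (2 / y ^+ 2).
  have y2t : y * (y * t) < 2.
    by move: ty; rewrite ltr_pdivlMr ?exprn_gt0// expr2; nra.
  have yt0 : 0 < y * t by rewrite mulr_gt0.
  pose b := y^-1 + y * t / 2.
  have ytb : y * t < b by rewrite /b; nra.
  have b4 : b <= 4 by rewrite /b; nra.
  rewrite (@integral_burgers_restrict _ _ `[0, b]%classic); last 2 first.
  - by move=> x/=; rewrite !in_itv/= => /andP[x0 x1]; apply/andP; split; lra.
  - move=> x/=; rewrite in_itv/= /burgers tn ty -/b => /negP.
    by rewrite negb_and -ltNge; case: ifPn => //; rewrite -leNgt => x0 /=;
      rewrite -ltNge => bx; rewrite ltNge (ltW (lt_trans ytb bx))/= leNgt bx.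
  have -> : `[0, b]%classic = `[0, y * t[%classic `|` `[y * t, b]%classic :> set R.
    by rewrite -itv_bndbnd_setU ?bnd_simp// ltW.
  rewrite ge0_integral_setU//=; last 3 first.
  - by apply/measurable_EFinP/measurable_funTS; exact: measurable_burgers.
  - by move=> x _; rewrite lee_fin burgers_ge0// ltW.
  - apply/disj_setPS => x [/=]; rewrite 2!in_itv/= => /andP[_ xyt] /andP[].
    by rewrite leNgt xyt.
  rewrite (@eq_integral _ (measurableTypeR R) R mu _ (fun x : R => (x / t)%:E)); last first.
    move=> x; rewrite inE/= in_itv/= /burgers tn ty => /andP[x0 ->].
    by rewrite ltNge x0.
  rewrite [X in (_ + X)%E](eq_integral (cst y%:E)); last first.
    move=> x; rewrite inE/= in_itv/= /burgers tn ty -/b => /andP[x0 ->].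
    by rewrite !ltNge x0/= (le_trans _ x0)// ltW.
  rewrite integral_itv_bndo_bndc; last first.
    by apply/measurable_EFinP/measurable_funTS; exact: measurable_funM.
  rewrite integral_ramp// integral_cst//= lebesgue_measure_itv/= lte_fin ytb.
  rewrite -EFinB -EFinM -EFinD; congr EFin; rewrite /b.
  by field; rewrite !gt_eqF.
have s0 : 0 < Num.sqrt (2 * t) by rewrite sqrtr_gt0 mulr_gt0.
have s2 : Num.sqrt (2 * t) ^+ 2 = 2 * t by rewrite sqr_sqrtr// mulr_ge0// ltW.
have s4 : Num.sqrt (2 * t) <= 4 by nra.
rewrite (@integral_burgers_restrict _ _ `[0, Num.sqrt (2 * t)]%classic); last 2 first.
- by move=> x/=; rewrite !in_itv/= => /andP[x0 x1]; apply/andP; split; lra.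
- move=> x/=; rewrite in_itv/= /burgers tn ltNge ty/= => /negP.
  by rewrite negb_and -ltNge; case: ifPn => //= _ /negbTE ->.
rewrite (@eq_integral _ (measurableTypeR R) R mu _ (fun x : R => (x / t)%:E)); last first.
  move=> x; rewrite inE/= in_itv/= /burgers tn (ltNge t) ty => /andP[x0 ->].
  by rewrite ltNge x0.
by rewrite integral_ramp// s2 mulfV// gt_eqF// mulr_gt0.
Qed.

(* The probability measure on [-1,4] with density [burgers y t], as a measure
   on the real line. *)
Definition burgers_prob y t (ht : 0 <= t <= 5) (hy : 1 / 2 <= y <= 3)
    : set (measurableTypeR R) -> \bar R :=
  fun U => (\int[mu]_(x in U `&` `[(-1)%R, 4%R]) (burgers y t x)%:E)%E.

Section instances.
Variables (y t : R) (ht : 0 <= t <= 5) (hy : 1 / 2 <= y <= 3).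

Let dens_ge0 x : (0 <= (burgers y t x)%:E)%E.
Proof.
have /andP[t0 _] := ht; have /andP[y0 _] := hy.
by rewrite lee_fin burgers_ge0// (le_trans _ y0)// divr_ge0.
Qed.

Let burgers0 : burgers_prob ht hy set0 = 0%E.
Proof. by rewrite /burgers_prob set0I integral_set0. Qed.

Let burgers_prob_ge0 U : (0 <= burgers_prob ht hy U)%E.
Proof. by apply: integral_ge0 => x _; exact: dens_ge0. Qed.

Let burgers_sigma_additive : semi_sigma_additive (burgers_prob ht hy).
Proof.
move=> /= F mF tF mUF; rewrite /burgers_prob; apply: cvg_toP.
  apply: ereal_nondecreasing_is_cvgn => m n mn.
  apply: lee_sum_nneg_natr => // k _ _.
  by apply: integral_ge0 => x _; exact: dens_ge0.
rewrite setI_bigcupl ge0_integral_bigcup//=.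
- by move=> k; exact: measurableI.
- by apply/measurable_EFinP/measurable_funTS; exact: measurable_burgers.
- exact: trivIset_setIr.
Qed.

HB.instance Definition _ := isMeasure.Build _ _ _ (burgers_prob ht hy)
  burgers0 burgers_prob_ge0 burgers_sigma_additive.

Let burgers_probT : burgers_prob ht hy [set: _] = 1%:E.
Proof. by rewrite /burgers_prob setTI integral_burgers. Qed.

HB.instance Definition _ := @Measure_isProbability.Build _ _ R
  (burgers_prob ht hy) burgers_probT.

End instances.
End burgers.

Definition burgers_manifold {R : realType}
    (w : probability (measurableTypeR R) R) : set (L2_01 R) :=
  [set v | exists (t y : R) (ht : 0 <= t <= 5) (hy : 1 / 2 <= y <= 3),
     v = icdf_L2 (-1) 4 (burgers_prob ht hy) - icdf_L2 (-1) 4 w].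

(* Main.v *)
Require Import Defs.
From HB Require Import structures.
From mathcomp Require Import all_boot all_order all_algebra.
From mathcomp Require Import all_classical all_reals all_analysis.
From mathcomp Require Import measurable_realfun.
From mathcomp Require Import ring lra zify.

(* With [r = sqrt s] and [b = y * sqrt (t / 2)], the quantile function of
   u_{y,t} is [(s + b^2 - (max 0 (b - r))^2) / y] for all [t] and [y], before
   and after the rarefaction wave has caught up with the shock. Cut [0,1] into
   N cells of length 1/N in the variable [r]: this function is a quadratic
   polynomial in [r] on each cell, except on the one containing [b], where
   dropping the square costs at most 2/N^2. That cell has measure at most 2/N
   in the variable [s], so the span of the quantile function of w and of the
   3N piecewise monomials in [r] is within O(N^(-5/2)) of the manifold, which
   is better than the claimed rate. *)

Set Implicit Arguments.
Unset Strict Implicit.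
Unset Printing Implicit Defensive.

Import Order.TTheory GRing.Theory Num.Theory.
Import numFieldNormedType.Exports.

Local Open Scope classical_set_scope.
Local Open Scope ring_scope.

(** * Linear algebra modulo null vectors, and width bounds from finite families *)

Section width_of_finite_family.
Context {R : realType} {V : lmodType R} (N : V -> \bar R).
Context (N_ge0 : forall u, (0 <= N u)%E) (N0 : N 0 = 0%E)
  (ND : forall u v, (N (u + v) <= N u + N v)%E)
  (NZ : forall a u, N u = 0%E -> N (a *: u) = 0%E).

Definition independent (k : nat) (e : 'I_k -> V) :=
  forall c : 'I_k -> R, N (\sum_(i < k) c i *: e i) = 0%E -> forall i, c i = 0.

(** Vectors stand for classes modulo [N = 0], so lying in the span is asked only up to a null
    vector. *)
Definition spans (k : nat) (e : 'I_k -> V) (v : V) :=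
  exists c : 'I_k -> R, N (v - \sum_(i < k) c i *: e i) = 0%E.

Lemma N_addr_null u z : N z = 0%E -> (N (u + z) <= N u)%E.
Proof. by move=> z0; rewrite (le_trans (ND u z))// z0 adde0. Qed.

Lemma null_add u z : N u = 0%E -> N z = 0%E -> N (u + z) = 0%E.
Proof.
by move=> u0 z0; apply/eqP; rewrite eq_le N_ge0 andbT -u0 N_addr_null.
Qed.

Lemma null_sum (I : finType) (z : I -> V) :
  (forall i, N (z i) = 0%E) -> N (\sum_i z i) = 0%E.
Proof.
by move=> z0; apply: (big_ind (fun u => N u = 0%E)) => //; exact: null_add.
Qed.

(** A null relation with a nonzero coefficient on [v] could be divided by that coefficient, which
    would put [v] in the span of [e]. *)
Lemma independent_extend k (e : 'I_k -> V) v : independent e -> ~ spans e v ->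
  exists e' : 'I_k.+1 -> V,
    [/\ independent e', spans e' v & forall u, spans e u -> spans e' u].
Proof.
(* [unlift] sends [ord_max] to [None], so [v] comes last and [e] fills the other indices. *)
move=> ie ev; exists (fun i => oapp e v (unlift ord_max i)).
have lst : unlift (@ord_max k) ord_max = None by exact: unlift_none.
have wid (i : 'I_k) : unlift ord_max (widen_ord (leqnSn k) i) = Some i.
  have -> : widen_ord (leqnSn k) i = lift ord_max i.
    by apply/val_inj; rewrite /= /bump leqNgt ltn_ord.
  by rewrite liftK.
have sumE c : \sum_(i < k.+1) c i *: oapp e v (unlift ord_max i) =
    \sum_(i < k) c (widen_ord (leqnSn k) i) *: e i + c ord_max *: v.
  by rewrite big_ord_recr/= lst/=; under eq_bigr do rewrite wid.
split.
- move=> c; rewrite sumE => c0.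
  have cmax : c ord_max = 0.
    apply/eqP/negPn/negP => cn; apply: ev.
    exists (fun i => - (c ord_max)^-1 * c (widen_ord (leqnSn k) i)).
    have := NZ (c ord_max)^-1 c0.
    rewrite scalerDr scalerA mulVf// scale1r addrC => <-; congr (N (_ + _)).
    rewrite scaler_sumr -sumrN; apply: eq_bigr => i _.
    by rewrite scalerA mulNr scaleNr opprK.
  move: c0; rewrite cmax scale0r addr0 => /ie ci i.
  have [j ->|->//] := unliftP ord_max i.
  rewrite -(ci j); congr c; apply/val_inj.
  by rewrite /= /bump leqNgt ltn_ord.
- exists (fun i => (i == ord_max)%:R); rewrite sumE eqxx scale1r big1 ?add0r ?subrr//.
  by move=> i _; rewrite -val_eqE/= ltn_eqF// scale0r.
- move=> u [c cu]; exists (fun i => oapp c 0 (unlift ord_max i)).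
  rewrite sumE lst/= scale0r addr0 -[RHS]cu; congr (N (_ - _)).
  by apply: eq_bigr => i _; rewrite wid.
Qed.

Lemma spans_independent (vs : seq V) : exists k (e : 'I_k -> V),
  [/\ (k <= size vs)%N, independent e & forall v, v \in vs -> spans e v].
Proof.
elim: vs => [|v vs [k [e [ks ie es]]]].
  by exists 0, (fun=> 0); split=> // c _ [].
have [ev|ev] := pselect (spans e v).
  exists k, e; split=> //=; first exact: leqW.
  by move=> u; rewrite inE => /orP[/eqP->//|/es].
have [e' [ie' ev' ee']] := independent_extend ie ev.
exists k.+1, e'; split=> //= u.
by rewrite inE => /orP[/eqP->//|/es/ee'].
Qed.

(** Otherwise the coefficients of the [p j] would form a matrix with [k.+1] rows and [k] columns,
    and a nonzero vector of its left kernel would give a null relation between the [p j]. *)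
Lemma spans_card_le k (e : 'I_k -> V) (p : 'I_k.+1 -> V) :
  independent p -> ~ (forall j, spans e (p j)).
Proof.
move=> ip /choice[C pC].
pose M := \matrix_(j, i) C j i.
have kM : kermx M != 0.
  rewrite -mxrank_eq0 mxrank_ker subn_eq0 -ltnNge.
  by rewrite (leq_ltn_trans (rank_leq_col M)).
have [u uM u0] : exists2 u : 'rV[R]_k.+1, u *m M = 0 & u != 0.
  move/rowV0Pn : kM => [u uk u0]; exists u => //; exact/sub_kermxP.
move/eqP : u0; apply; apply/rowP => j; rewrite mxE.
apply: (ip (fun j => u 0 j)).
(* Because [u *m M = 0], subtracting the combinations of [e] changes nothing, and each bracket is
   null. *)
rewrite [X in N X](_ : _ = \sum_j u 0 j *: (p j - \sum_(i < k) C j i *: e i)).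
  by apply: null_sum => i; exact: NZ.
under [RHS]eq_bigr do rewrite scalerBr.
rewrite sumrB [X in _ = _ - X](_ : _ = 0) ?subr0//.
under eq_bigr do rewrite scaler_sumr.
rewrite exchange_big/= big1// => i _.
have /rowP/(_ i) := uM; rewrite !mxE => uMi.
rewrite -[RHS](scale0r (e i)) -uMi scaler_suml; apply: eq_bigr => l _.
by rewrite scalerA mxE.
Qed.

(** The width ranges over subspaces of dimension exactly [n], so a smaller family has to be padded:
    among more independent vectors than it has, one lies outside its span. *)
Lemma spans_independent_dim (infdim : forall k, exists p : 'I_k -> V, independent p)
    (vs : seq V) n : (size vs <= n)%N ->
  exists e : 'I_n -> V, independent e /\ forall v, v \in vs -> spans e v.
Proof.
have [k [e [ks ie es]]] := spans_independent vs.
move=> /(leq_trans ks) {ks}/subnK <-; elim: (n - k)%N => [|m [f [indf fs]]].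
  by exists e.
have [p ip] := infdim (m + k).+1.
have /existsNP[j fj] := spans_card_le (e := f) ip.
have [f' [if' _ ff']] := independent_extend indf fj.
by exists f'; split=> // v /fs/ff'.
Qed.

(* An approximating family may be dependent and smaller than [n]: it is
   reduced and then completed to [n] independent vectors. *)
Lemma kolmogorov_width_le
    (infdim : forall k, exists p : 'I_k -> V, independent p)
    (S : set V) (I : finType) (e : I -> V) (n : nat) (d : \bar R) :
  (#|I| <= n)%N ->
  (forall v, S v -> exists c : I -> R, (N (v - \sum_i c i *: e i) <= d)%E) ->
  (kolmogorov_width N S n <= d)%E.
Proof.
move=> In Se.
have [|f [indf fs]] := @spans_independent_dim infdim [seq e i | i : I] n.
  by rewrite size_map -cardE.
have /choice[D eD] i : spans f (e i) by apply: fs; apply: map_f; rewrite mem_enum.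
apply: ge_ereal_inf; exists (ereal_sup [set ereal_inf [set N (v - g) |
  g in [set v | exists c : 'I_n -> R, v = \sum_(i < n) c i *: f i]] | v in S]).
  by exists [set v | exists c : 'I_n -> R, v = \sum_(i < n) c i *: f i] => //; exists f.
apply: ge_ereal_sup => _ [v Sv <-].
have [c vc] := Se _ Sv.
apply: ge_ereal_inf; exists (N (v - \sum_(j < n) (\sum_i c i * D i j) *: f j)).
  by eexists => //; eexists.
apply: le_trans vc.
(* Trading each [e i] for its coordinates in [f] alters the error by a null vector only. *)
rewrite [X in N X](_ : _ = (v - \sum_i c i *: e i) +
    \sum_i c i *: (e i - \sum_(j < n) D i j *: f j)).
  by apply: N_addr_null; apply: null_sum => i; exact: NZ.
under [X in _ = _ + X]eq_bigr do rewrite scalerBr.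
rewrite sumrB addrA subrK; congr (_ - _).
under [RHS]eq_bigr do rewrite scaler_sumr.
rewrite exchange_big/=; apply: eq_bigr => j _.
by rewrite scaler_suml; apply: eq_bigr => i _; rewrite scalerA.
Qed.

End width_of_finite_family.

(** * Norm estimates in L^2([0,1]) *)

Section L2_lemmas.
Context {R : realType}.
Local Notation mu := (@lebesgue01 R).
Implicit Types (f : R -> R) (M L : R).

(** Almost everywhere the square of [f] is at most [M ^ 2] times the indicator of [A], whose
    integral is at most [L]. *)
Lemma Lnorm_le_indic f M L (A : set R) : measurable_fun [set: measurableTypeR R] f ->
  measurable A -> 0 <= M -> 0 <= L -> (mu A <= L%:E)%E ->
  (\forall x \ae mu, `|f x| <= M * \1_A x) ->
  ('N[mu]_(2%:R%:E)[EFin \o f] <= (M * Num.sqrt L)%:E)%E.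
Proof.
move=> mf mA M0 L0 AL fM; rewrite unlock.
have -> : ((M * Num.sqrt L)%:E = ((M ^+ 2 * L)%:E) `^ 2%:R^-1)%E.
  by rewrite poweR12_sqrt ?lee_fin ?mulr_ge0// ?sqr_ge0//= sqrtrM ?sqr_ge0// sqrtr_sqr ger0_norm.
apply: gt0_ler_poweR; rewrite ?invr_ge0// ?in_itv/= ?leey ?andbT//.
- by apply: integral_ge0 => x _; rewrite lee_fin powR_ge0.
- by rewrite lee_fin mulr_ge0// sqr_ge0.
apply: (@le_trans _ _ (\int[mu]_x ((M ^+ 2)%:E * (\1_A x)%:E))%E).
  apply: ae_ge0_le_integral => //.
  - apply/measurable_EFinP; apply: (measurableT_comp (measurable_powR _)) => //.
    by apply: measurableT_comp.
  - by move=> x _; rewrite -EFinM lee_fin mulr_ge0// sqr_ge0.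
  - by apply/measurable_EFinP; apply: measurable_funM => //; exact: measurable_indic.
  move: fM; apply: filterS; first exact: (ae_filter_ringOfSetsType mu).
  move=> x fMx _; rewrite /= -EFinM lee_fin.
  rewrite powR_mulrn// -[X in M ^+ 2 * X](_ : (\1_A x) ^+ 2 = _) -?exprMn.
    by rewrite lerXn2r// nnegrE// mulr_ge0.
  by rewrite indicE; case: (_ \in _); rewrite ?expr1n ?expr0n.
rewrite ge0_integralZl ?lee_fin ?sqr_ge0//; last first.
  by apply/measurable_EFinP; exact: measurable_indic.
by rewrite integral_indic// setIT [leRHS]EFinM; apply: lee_wpmul2l => //; rewrite lee_fin sqr_ge0.
Qed.

Lemma bounded_Lfun f M : measurable_fun [set: measurableTypeR R] f ->
  (forall x, `|f x| <= M) -> f \in Lfun mu 2%:R%:E.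
Proof.
move=> mf fM; rewrite inE; apply/andP; split; rewrite inE//= /finite_norm.
have M0 : 0 <= M by rewrite (le_trans _ (fM 0)).
apply: (@le_lt_trans _ _ (M * Num.sqrt 1)%:E); last exact: ltry.
apply: (@Lnorm_le_indic _ _ _ setT) => //.
  rewrite [X in (X <= _)%E](_ : _ = lebesgue_measure (`[0, 1]%classic : set R)); last first.
    exact: (congr1 lebesgue_measure (setTI _)).
  rewrite lebesgue_measure_itv/=.
  by rewrite lte_fin ltr01 -EFinD subr0.
by apply: aeW => x; rewrite indicT mulr1.
Qed.

Definition bounded_L2 f M (mf : measurable_fun [set: measurableTypeR R] f)
    (fM : forall x, `|f x| <= M) : L2_01 R :=
  Lfun_Sub one_le_two (bounded_Lfun mf fM).

Lemma L2_subE (f g : L2_01 R) x : (f - g) x = f x - g x.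
Proof. by []. Qed.

Lemma L2_scaleE a (f : L2_01 R) x : (a *: f) x = a * f x.
Proof. by []. Qed.

Lemma L2_sumE (I : finType) (F : I -> L2_01 R) x :
  (\sum_i F i) x = \sum_i F i x.
Proof. by elim/big_ind2 : _ => // f a g b <- <-. Qed.

Lemma L2_norm0 : L2_norm (0 : L2_01 R) = 0%E.
Proof. by rewrite /L2_norm -[RHS](@Lnorm0 _ _ _ mu 2%:R%:E)//. Qed.

Lemma L2_normD (f g : L2_01 R) : (L2_norm (f + g)%R <= L2_norm f + L2_norm g)%E.
Proof. by apply: eminkowski => //; rewrite lee_fin ler1n. Qed.

Lemma L2_normZ a (f : L2_01 R) : L2_norm (a *: f) = (`|a|%:E * L2_norm f)%E.
Proof. exact: LnormZ. Qed.

End L2_lemmas.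

(** * Piecewise monomials in the square root of the variable *)

Section cells.
Context {R : realType}.
Local Notation mu := (@lebesgue01 R).

(** The two endpoints form a null set; discarding them avoids the conventional value of [icdf] at
    [s = 1]. *)
Lemma ae_lebesgue01 (P : R -> Prop) :
  (forall s, 0 < s < 1 -> P s) -> \forall s \ae mu, P s.
Proof.
move=> P01; exists (~` `]0, 1[%classic); split.
- by apply: measurableC; exact: measurable_itv.
- rewrite /lebesgue01 /= /mrestr; apply: countable_lebesgue_measure0.
  apply: (@sub_countable _ _ _ [set 0; 1]); last exact: finite_set_countable.
  apply: subset_card_le => x [/= /negP]; rewrite !in_itv/= negb_and -!leNgt.
  move=> /orP[x0|x1] /andP[x0' x1'].
    by left; apply/eqP; rewrite eq_le x0.
  by right; apply/eqP; rewrite eq_le x1'.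
- by move=> s /= Ps s01; apply: Ps; apply: P01; move: s01; rewrite in_itv.
Qed.

(** Otherwise the interval, of length [b - a > 0], would be negligible. *)
Lemma ae_lebesgue01_ex (P : R -> Prop) (a b : R) : 0 <= a -> a < b -> b <= 1 ->
  (\forall s \ae mu, P s) -> exists2 s, a < s < b & P s.
Proof.
move=> a0 ab b1 aeP; apply/not_exists2P => nP.
have : mu.-negligible (`]a, b[%classic : set R).
  apply: negligibleS aeP => s /=; rewrite in_itv/= => sab.
  by case: (nP s) => [/(_ sab)|].
move/measure_negligible => /(_ (measurable_itv _)); rewrite /lebesgue01/= /mrestr.
rewrite setIidl; last first.
  move=> s /=; rewrite !in_itv/= => /andP[as' sb].
  by rewrite (le_trans a0 (ltW as'))/= (le_trans (ltW sb)).
rewrite lebesgue_measure_itv/= lte_fin ab -EFinB => /eqP.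
by rewrite eqe subr_eq0 gt_eqF.
Qed.

(* [s] lies in the i-th cell of the uniform partition in [sqrt s]. *)
Definition cell (N i : nat) (s : R) :=
  i%:R <= N%:R * Num.sqrt s < i.+1%:R.

Definition cell_monomial (N i j : nat) (s : R) : R :=
  if cell N i s then Num.sqrt s ^+ j else 0.

Lemma cell_uniq N i k s : cell N i s -> cell N k s -> i = k.
Proof.
move=> /andP[li ui] /andP[lk uk]; apply/eqP; rewrite eqn_leq.
have := le_lt_trans li uk; have := le_lt_trans lk ui.
by rewrite !ltr_nat !ltnS => -> ->.
Qed.

Lemma sum_cell N (k : 'I_N) s (F : 'I_N -> R) : cell N k s ->
  \sum_(i < N) (if cell N i s then F i else 0) = F k.
Proof.
move=> ck; rewrite (bigD1 k)//= ck big1 ?addr0// => i ik.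
by case: ifPn => // /cell_uniq/(_ ck)/val_inj ik'; rewrite ik' eqxx in ik.
Qed.

Lemma ex_cell N s : (0 < N)%N -> 0 <= s < 1 -> exists k : 'I_N, cell N k s.
Proof.
move=> N0 /andP[s0 s1].
have Ns0 : 0 <= N%:R * Num.sqrt s by rewrite mulr_ge0// sqrtr_ge0.
have /andP[l u] := truncn_itv Ns0.
(* The cells are half-open: [s < 1] is what keeps the index below [N]. *)
have kN : (Num.truncn (N%:R * Num.sqrt s) < N)%N.
  rewrite -(@ltr_nat R) (le_lt_trans l)// gtr_pMr ?ltr0n//.
  by rewrite -sqrtr1 ltr_sqrt.
by exists (Ordinal kN); apply/andP.
Qed.

Lemma measurable_sqrt : measurable_fun [set: R] (@Num.sqrt R).
Proof. by apply: continuous_measurable_fun; exact: sqrt_continuous. Qed.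

Lemma measurable_cell_monomial N i j :
  measurable_fun [set: measurableTypeR R] (cell_monomial N i j).
Proof.
have mN : measurable_fun [set: R] (fun s : R => N%:R * Num.sqrt s).
  by apply: measurable_funM => //; exact: measurable_sqrt.
apply: measurable_fun_ifT => //.
  by apply: measurable_and => //; [exact: measurable_fun_ler|exact: measurable_fun_ltr].
by apply: measurable_funX; exact: measurable_sqrt.
Qed.

(** Valid for every real [s], as [i < N] forces [Num.sqrt s < 1] on the cell. *)
Lemma cell_monomial_le1 N i j s : (i < N)%N -> `|cell_monomial N i j s| <= 1.
Proof.
move=> iN; rewrite /cell_monomial; case: ifPn; last by rewrite normr0.
move=> /andP[_ u]; rewrite normrX ger0_norm ?sqrtr_ge0//.
rewrite exprn_ile1 ?sqrtr_ge0//.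
have N0 : 0 < N%:R :> R by rewrite ltr0n (leq_trans _ iN).
rewrite -(ler_pM2l N0) mulr1 (le_trans (ltW u))//.
by rewrite ler_nat.
Qed.

Definition cell_L2 N (i : 'I_N) j : L2_01 R :=
  bounded_L2 (measurable_cell_monomial N i j)
    (fun s => cell_monomial_le1 j s (ltn_ord i)).

Lemma cell_L2E N (i : 'I_N) j s : cell_L2 i j s = cell_monomial N i j s.
Proof. by []. Qed.

(** The cells are disjoint and not null, so a null combination evaluated at a suitable point of cell
    [i] leaves only [c i]. As [N] is arbitrary, L^2([0,1]) has infinite dimension. *)
Lemma independent_cell_L2 N :
  independent (@L2_norm R) (fun i : 'I_N => cell_L2 i 0).
Proof.
move=> c c0 i.
have N0 : 0 < N%:R :> R by rewrite ltr0n (leq_ltn_trans _ (ltn_ord i)).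
have {}c0 : \forall s \ae mu, (\sum_(i < N) c i *: cell_L2 i 0) s = 0.
  have : EFin \o (\sum_(i < N) c i *: cell_L2 i 0 : L2_01 R) = \0%E %[ae mu].
    by apply: Lnorm_eq0_eq0 c0 => //; exact/measurable_EFinP.
  apply: (@filterS _ _ (ae_filter_ringOfSetsType mu)).
  by move=> s /(_ I) [].
(* These bounds are the ends of cell [i] in the variable [s]. *)
have [] := @ae_lebesgue01_ex _ ((i%:R / N%:R) ^+ 2) ((i.+1%:R / N%:R) ^+ 2) _ _ _ c0.
- by rewrite sqr_ge0.
- by rewrite ltrXn2r// ?nnegrE ?divr_ge0// ltr_pM2r ?invr_gt0// ltr_nat.
- by rewrite exprn_ile1// ?divr_ge0// ler_pdivrMr// mul1r ler_nat.
move=> s /andP[ls us]; have s0 : 0 <= s by rewrite (le_trans _ (ltW ls)) ?sqr_ge0.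
have ci : cell N i s.
  rewrite /cell; apply/andP; split.
    rewrite mulrC -ler_pdivrMr// -(ler_pXn2r (n := 2))// ?nnegrE ?divr_ge0 ?sqrtr_ge0//.
    by rewrite sqr_sqrtr// ltW.
  rewrite mulrC -ltr_pdivlMr// -(ltr_pXn2r (n := 2))// ?nnegrE ?divr_ge0 ?sqrtr_ge0//.
  by rewrite sqr_sqrtr.
rewrite L2_sumE => <-.
rewrite -(@sum_cell _ i s c)//; apply: eq_bigr => k _.
rewrite L2_scaleE cell_L2E /cell_monomial expr0.
by case: ifP => _; rewrite ?mulr1 ?mulr0.
Qed.

End cells.

(** * The quantile function of the Burgers solution *)

Section burgers_icdf.
Context {R : realType}.
Implicit Types t y x s : R.
Local Notation lambda := (@lebesgue_measure R).

(* With [a = y^2 t / 2] the mass of the rarefaction wave, the quantile function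
   is [sqrt (2 t s)] below [a] and [s / y + y t / 2] above it. *)
Definition burgers_quantile y t s : R :=
  let a := y ^+ 2 * t / 2 in
  (s + a - (Num.max 0 (Num.sqrt a - Num.sqrt s)) ^+ 2) / y.

Lemma integral_ramp t c : 0 < t -> 0 < c ->
  (\int[lambda]_(x in `[0%R, c]) (x / t)%:E)%E = (c ^+ 2 / (2 * t))%:E.
Proof.
move=> t0 c0.
have dF x : is_derive x 1 (fun z : R => z ^+ 2 / (2 * t)) (x / t).
  apply: is_derive_eq; rewrite scaler0 add0r /GRing.scale/= mulr1.
  by field; rewrite gt_eqF.
have cF : continuous (fun z : R => z ^+ 2 / (2 * t)).
  by move=> x; apply/differentiable_continuous/derivable1_diffP; have [] := dF x.
rewrite (@continuous_FTC2 _ _ (fun z : R => z ^+ 2 / (2 * t)))//.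
- by rewrite -EFinB expr0n/= mul0r subr0.
- by apply: continuous_subspaceT => x; apply: cvgM; [exact: cvg_id|exact: cvg_cst].
- split; first by move=> x _; have [] := dF x.
  + exact/cvg_at_right_filter/cF.
  + exact/cvg_at_left_filter/cF.
- by move=> x _; rewrite derive1E; have [] := dF x.
Qed.

Lemma burgers_lt0 y t x : x < 0 -> burgers y t x = 0.
Proof.
by move=> x0; rewrite /burgers leNgt x0/=; case: ifP => // _; case: ifP.
Qed.

Lemma burgers_prob_itv y t x (ht : 0 <= t <= 5) (hy : 1 / 2 <= y <= 3) :
  0 <= x <= 4 -> burgers_prob ht hy `[-1, x] =
  (\int[lambda]_(z in `[0%R, x]) (burgers y t z)%:E)%E.
Proof.
move=> /andP[x0 x4]; rewrite /burgers_prob integral_mkcond [RHS]integral_mkcond.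
apply: eq_integral => z _; rewrite /patch.
case: ifPn => [|]; rewrite ?inE ?notin_setE/= !in_itv/=.
  move=> [/andP[z1 zx] _]; case: ifPn => //.
  rewrite notin_setE/= in_itv/= zx andbT => /negP.
  by rewrite -ltNge => /burgers_lt0 ->.
move=> nz; case: ifPn => //; rewrite inE/= in_itv/= => /andP[z0 zx].
by exfalso; apply: nz; split; apply/andP; split; lra.
Qed.

(** Expanding the square leaves [2 * Num.sqrt a * Num.sqrt s / y], that is [Num.sqrt (2 * t * s)];
    the value is recorded through its sign and its square. *)
Lemma burgers_quantile_lt y t s : 0 < y -> 0 < t -> 0 < s ->
  s < y ^+ 2 * t / 2 -> 0 < burgers_quantile y t s /\
  burgers_quantile y t s ^+ 2 = 2 * t * s.
Proof.
move=> y0 t0 s0 sa; rewrite /burgers_quantile.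
set a := y ^+ 2 * t / 2 in sa *.
have a0 : 0 < a by rewrite (lt_trans s0).
have sas : Num.sqrt s < Num.sqrt a by rewrite ltr_sqrt.
rewrite max_r; last by rewrite subr_ge0 ltW.
have sa0 : 0 < Num.sqrt a by rewrite sqrtr_gt0.
have ss0 : 0 < Num.sqrt s by rewrite sqrtr_gt0.
have as2 : Num.sqrt a ^+ 2 = a by rewrite sqr_sqrtr// ltW.
have ss2 : Num.sqrt s ^+ 2 = s by rewrite sqr_sqrtr// ltW.
have -> : (s + a - (Num.sqrt a - Num.sqrt s) ^+ 2) / y =
    2 * Num.sqrt a * Num.sqrt s / y.
  by rewrite -{1}as2 -{1}ss2; congr (_ / _); ring.
split; first by rewrite divr_gt0// !mulr_gt0.
rewrite !exprMn as2 ss2 /a; field; by rewrite gt_eqF.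
Qed.

Lemma burgers_quantile_ge y t s : 0 <= s -> 0 <= t ->
  y ^+ 2 * t / 2 <= s ->
  burgers_quantile y t s = s / y + y ^+ 2 * t / 2 / y.
Proof.
move=> s0 t0 sa; rewrite /burgers_quantile max_l ?subr_le0 ?ler_sqrt//.
by rewrite expr0n/= subr0 mulrDl.
Qed.

(** With [a = y ^+ 2 * t / 2]: if [s < a] the square is [2 * t * s < 16]; otherwise the value is at
    most [2 * s / y], and [1 / y <= 2]. *)
Lemma burgers_quantile_itv y t s : 0 <= t <= 5 -> 1 / 2 <= y <= 3 -> 0 < s < 1 ->
  0 < burgers_quantile y t s <= 4.
Proof.
move=> /andP[t0 t5] /andP[yl yu] /andP[s0 s1].
have y0 : 0 < y by lra.
have [sa|sa] := ltP s (y ^+ 2 * t / 2).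
  have {}t0 : 0 < t.
    rewrite lt_neqAle t0 andbT; apply/eqP => t0'; move: sa.
    by rewrite -t0' mulr0 mul0r ltNge ltW.
  have [q0 q2] := burgers_quantile_lt y0 t0 s0 sa.
  rewrite q0/=; nra.
rewrite burgers_quantile_ge//; last exact: ltW.
have yi0 : 0 < y^-1 by rewrite invr_gt0.
have yi2 : y^-1 <= 2 by rewrite invf_ple ?posrE//; lra.
have : 0 <= y ^+ 2 * t / 2 by rewrite divr_ge0// mulr_ge0// sqr_ge0.
set a := _ / 2 in sa * => a0.
apply/andP; split; nra.
Qed.

(** Three cases: the initial datum, a quantile on the ramp, a quantile on the plateau. *)
Lemma burgers_cdf y t s (ht : 0 <= t <= 5) (hy : 1 / 2 <= y <= 3) : 0 < s < 1 ->
  burgers_prob ht hy `[-1, burgers_quantile y t s] = s%:E.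
Proof.
move=> s01.
have /andP[q0 q4] := burgers_quantile_itv ht hy s01.
rewrite burgers_prob_itv ?(ltW q0)//.
have /andP[t0 t5] := ht; have /andP[yl yu] := hy; have /andP[s0 s1] := s01.
have y0 : 0 < y by lra.
have yy : y * y^-1 = 1 by rewrite mulfV// gt_eqF.
have [te|tn] := eqVneq t 0.
  have qE : burgers_quantile y t s = s / y.
    have a0 : y ^+ 2 * t / 2 = 0 by rewrite te mulr0 mul0r.
    by rewrite burgers_quantile_ge ?a0 ?mul0r ?addr0// ltW.
  rewrite qE in q0 q4 *.
  rewrite (eq_integral (cst y%:E)); last first.
    move=> x; rewrite inE/= in_itv/= /burgers te eqxx => /andP[-> xs]/=.
    by rewrite (le_lt_trans xs)// ltr_pdivrMr// mulVf ?gt_eqF.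
  rewrite integral_cst//= lebesgue_measure_itv/= lte_fin q0.
  by rewrite -EFinD subr0 -EFinM mulrCA yy mulr1.
have {tn}t0' : 0 < t by rewrite lt_neqAle eq_sym tn.
have tn : (t == 0) = false by rewrite gt_eqF.
have [sa|sa] := ltP s (y ^+ 2 * t / 2).
  have [_ q2] := burgers_quantile_lt y0 t0' s0 sa.
  move: q0 q4 q2; move: (burgers_quantile y t s) => q q0 q4 q2.
  have q0' := ltW q0.
  rewrite (@eq_integral _ (measurableTypeR R) R lambda _ (fun x : R => (x / t)%:E)).
    rewrite integral_ramp// q2; congr EFin; field; by rewrite gt_eqF.
  move=> x; rewrite inE/= in_itv/= /burgers tn => /andP[x0 xq].
  (* Before and after the shock is caught up, [q] lies on the ramp: compare squares, using
     [q ^+ 2 = 2 * t * s]. *)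
  rewrite (ltNge x) x0/=; case: ifPn => ty.
    suff -> : x < y * t by [].
    apply: (le_lt_trans xq); rewrite -(ltr_pXn2r (n := 2))// ?nnegrE ?mulr_ge0// ?(ltW y0)//.
    rewrite q2; nra.
  suff -> : x <= Num.sqrt (2 * t) by [].
  rewrite (le_trans xq)// -(ler_pXn2r (n := 2))// ?nnegrE ?sqrtr_ge0//.
  by rewrite q2 sqr_sqrtr; nra.
have qE := burgers_quantile_ge (ltW s0) t0 sa.
move: q0 q4 qE; move: (burgers_quantile y t s) => q q0 q4 qE.
(* As [y ^+ 2 * t / 2 <= s < 1], the wave has not reached the shock yet. *)
have ty : t < 2 / y ^+ 2 by rewrite ltr_pdivlMr ?exprn_gt0//; nra.
have yt0 : 0 < y * t by rewrite mulr_gt0.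
have qyt : y * q = s + y ^+ 2 * t / 2.
  by rewrite qE; field; rewrite gt_eqF.
have ytq : y * t <= q by rewrite -(ler_pM2l y0) qyt; nra.
have qb : q <= y^-1 + y * t / 2 by rewrite -(ler_pM2l y0) qyt mulrDr yy; nra.
have -> : `[0, q]%classic = `[0, y * t[%classic `|` `[y * t, q]%classic :> set R.
  by rewrite -itv_bndbnd_setU ?bnd_simp// ltW.
rewrite ge0_integral_setU//=; last 3 first.
- by apply/measurable_EFinP/measurable_funTS; exact: measurable_burgers.
- by move=> x _; rewrite lee_fin burgers_ge0// ltW.
- apply/disj_setPS => x [/=]; rewrite 2!in_itv/= => /andP[_ xyt] /andP[].
  by rewrite leNgt xyt.
rewrite (@eq_integral _ (measurableTypeR R) R lambda _ (fun x : R => (x / t)%:E)); last first.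
  move=> x; rewrite inE/= in_itv/= /burgers tn ty => /andP[x0 ->].
  by rewrite ltNge x0.
rewrite [X in (_ + X)%E](eq_integral (cst y%:E)); last first.
  move=> x; rewrite inE/= in_itv/= /burgers tn ty => /andP[x0 xq].
  by rewrite !ltNge x0/= (le_trans (ltW yt0))//= (le_trans xq).
rewrite integral_itv_bndo_bndc; last first.
  by apply/measurable_EFinP/measurable_funTS; exact: measurable_funM.
rewrite integral_ramp// integral_cst//= lebesgue_measure_itv/= lte_fin.
case: ltP => ytq'.
  rewrite -EFinB -EFinM -EFinD mulrBr qyt; congr EFin.
  by field; rewrite !gt_eqF.
(* The plateau part has length zero, and [s] is exactly the mass of the ramp. *)
have eq : q = y * t by apply/eqP; rewrite eq_le ytq'.
rewrite mule0 adde0; congr EFin.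
have -> : s = y ^+ 2 * t / 2 by move: qyt; rewrite eq => h; lra.
by field; rewrite !gt_eqF.
Qed.

Lemma continuous_burgers_quantile y t : continuous (burgers_quantile y t).
Proof.
set a := y ^+ 2 * t / 2.
have cm : continuous (fun s : R => Num.max 0 (Num.sqrt a - Num.sqrt s)).
  move=> s; apply: (@continuous_max _ _ (cst 0) (fun s => Num.sqrt a - Num.sqrt s)).
    exact: cvg_cst.
  by apply: cvgB; [exact: cvg_cst|exact: sqrt_continuous].
move=> s; rewrite /burgers_quantile -/a.
under eq_fun do rewrite expr2.
apply: cvgM; last exact: cvg_cst.
apply: cvgB; first by apply: cvgD; [exact: cvg_id|exact: cvg_cst].
exact: (cvgM (cm s) (cm s)).
Qed.

(** The cdf equals [s'] at [burgers_quantile y t s']. For [s' > s] these points belong to the set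
    defining the infimum and tend to the claimed value by continuity; monotonicity of the cdf
    excludes every point to its left. *)
Lemma icdf_burgers y t s (ht : 0 <= t <= 5) (hy : 1 / 2 <= y <= 3) : 0 < s < 1 ->
  icdf (-1) 4 (burgers_prob ht hy) s = burgers_quantile y t s.
Proof.
move=> s01; have /andP[s0 s1] := s01.
pose P := (burgers_prob ht hy : probability (measurableTypeR R) R).
have Pmono x z : x <= z -> (P `[(-1)%R, x]%classic <= P `[(-1)%R, z]%classic)%E.
  move=> xz; apply: le_measure; rewrite ?inE//=; try exact: measurable_itv.
  exact: subitvPr.
have PE s' : 0 < s' < 1 -> P `[-1, burgers_quantile y t s']%classic = s'%:E.
  exact: burgers_cdf.
have above s' : s < s' -> s' < 1 -> icdf (-1) 4 P s <= burgers_quantile y t s'.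
  move=> ss' s'1; have s'01 : 0 < s' < 1 by rewrite s'1 (lt_trans s0).
  apply: ge_inf; first by exists (-1) => x [] /[!in_itv]/= /andP[].
  split; last by rewrite /cdf_from PE// lte_fin.
  have /andP[q0 q4] := burgers_quantile_itv ht hy s'01.
  by rewrite in_itv/= q4 andbT; lra.
apply/eqP; rewrite eq_le; apply/andP; split.
  have qs : burgers_quantile y t x @[x --> s^'+] --> burgers_quantile y t s.
    exact/cvg_at_right_filter/continuous_burgers_quantile.
  apply: (cvgr_to_ge qs); near=> x; apply: above; near: x.
    exact: nbhs_right_gt.
  exact: nbhs_right_lt.
(* The midpoint is a level strictly between [s] and 1, which shows that the set is nonempty. *)
have h1 : s < (s + 1) / 2 by lra.
have h2 : (s + 1) / 2 < 1 by lra.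
have h3 : 0 < (s + 1) / 2 < 1 by lra.
apply: lb_le_inf.
  exists (burgers_quantile y t ((s + 1) / 2)); split.
    have /andP[q0 q4] := burgers_quantile_itv ht hy h3.
    by rewrite in_itv/= q4 andbT; lra.
  by rewrite /cdf_from PE// lte_fin.
move=> x [_ sx]; rewrite leNgt; apply/negP => /ltW/Pmono.
by rewrite [X in (_ <= X)%E]PE// leNgt sx.
Unshelve. all: by end_near. Qed.

End burgers_icdf.

(** * Approximation on the cells and the resulting rate *)

Section burgers_approximation.
Context {R : realType}.
Implicit Types y t s : R.
Local Notation mu := (@lebesgue01 R).

(** Coefficients of 1, [r] and [r ^+ 2] for [r = Num.sqrt s]. Cells below [b] get [2 * b * r / y];
    the others, including the one containing [b], get [(a + r ^+ 2) / y]. *)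
Definition cell_coef (N : nat) y t (i j : nat) : R :=
  let a := y ^+ 2 * t / 2 in let b := Num.sqrt a in
  if i.+1%:R <= N%:R * b then [:: 0; 2 * b / y; 0]`_j
  else [:: a / y; 0; y^-1]`_j.

(** Exact unless [r < b] in the cell containing [b], where [b - r <= 1 / N] and [1 / y <= 2]. *)
Lemma burgers_quantile_cell (N k : nat) y t s (a := y ^+ 2 * t / 2) : (k < N)%N -> 1 / 2 <= y ->
  0 <= t -> 0 < s < 1 -> cell N k s ->
  `|burgers_quantile y t s - \sum_(j < 3) cell_coef N y t k j * Num.sqrt s ^+ j|
  <= 2 / N%:R ^+ 2 * \1_(`[a - 2 / N%:R, a]%classic : set R) s.
Proof.
move=> kN yl t0 /andP[s0 s1] /andP[lk uk].
have y0 : 0 < y by lra.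
have N0 : 0 < N%:R :> R by rewrite ltr0n (leq_ltn_trans _ kN).
have kN' : k.+1%:R <= N%:R :> R by rewrite ler_nat.
have a0 : 0 <= a by rewrite /a divr_ge0// mulr_ge0// sqr_ge0.
have ss2 : Num.sqrt s ^+ 2 = s by rewrite sqr_sqrtr// ltW.
have as2 : Num.sqrt a ^+ 2 = a by rewrite sqr_sqrtr.
rewrite !big_ord_recr big_ord0/= add0r /cell_coef /burgers_quantile -/a.
set b := Num.sqrt a in as2 *; set r := Num.sqrt s in ss2 lk uk *.
have b0 : 0 <= b by exact: sqrtr_ge0.
have r0 : 0 < r by rewrite sqrtr_gt0.
have rhs0 : 0 <= 2 / N%:R ^+ 2 * \1_(`[a - 2 / N%:R, a]%classic : set R) s :> R.
  by apply: mulr_ge0 => //; rewrite divr_ge0// sqr_ge0.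
rewrite expr0 expr1 mulr1.
case: ifPn => [kb|]; last rewrite -ltNge => kb.
- rewrite /= !mul0r add0r addr0.
  have rb : r < b by rewrite -(ltr_pM2l N0) (lt_le_trans uk).
  rewrite max_r; last by rewrite subr_ge0 ltW.
  rewrite [X in `|X|](_ : _ = 0) ?normr0//.
  by rewrite -as2 -ss2; ring.
- rewrite /= mul0r addr0 ss2.
  have [br|rb] := leP b r.
    rewrite max_l ?subr_le0// [X in `|X|](_ : _ = 0) ?normr0//.
    by rewrite expr0n/=; ring.
  rewrite max_r; last by rewrite subr_ge0 ltW.
  rewrite [X in `|X|](_ : _ = - ((b - r) ^+ 2 / y)); last by ring.
  have brN : N%:R * (b - r) <= 1.
    by move: lk kb; rewrite -natr1 mulrBr; lra.
  have b1 : b < 1.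
    by rewrite -(ltr_pM2l N0) mulr1 (lt_le_trans kb).
  (* Since [r < b < 1], the difference [a - s = (b - r) * (b + r)] is at most [2 / N]. *)
  rewrite indicE mem_set ?mulr1; last first.
    rewrite /= in_itv/= -as2 -ss2; apply/andP; split; last by nra.
    rewrite lerBlDl -lerBlDr ler_pdivlMr//; nra.
  rewrite normrN ger0_norm ?divr_ge0 ?sqr_ge0 ?(ltW y0)//.
  rewrite ler_pdivlMr ?exprn_gt0// mulrAC ler_pdivrMr//.
  rewrite -exprMn mulrC; have : 0 <= N%:R * (b - r) by rewrite mulr_ge0// subr_ge0 ltW.
  rewrite mulrC; nra.
Qed.

Lemma lebesgue01_itv_le (c d : R) : 0 <= d ->
  (mu `[(c - d)%R, c]%classic <= d%:E)%E.
Proof.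
move=> d0; rewrite /lebesgue01/= /mrestr.
apply: (@le_trans _ _ (lebesgue_measure (`[(c - d)%R, c]%classic : set R))).
  by apply: le_measure; rewrite ?inE//=; apply: measurableI; exact: measurable_itv.
rewrite lebesgue_measure_itv/= lte_fin; case: ifPn => // _.
by rewrite -EFinB lee_fin; lra.
Qed.

(** [g] will be the quantile function of [w], whose presence absorbs the translation in the
    manifold. There are [3 * N + 1] indices. *)
Definition width_family (g : L2_01 R) (N : nat) (i : 'I_1 + 'I_N * 'I_3) : L2_01 R :=
  match i with inl _ => g | inr p => cell_L2 p.1 p.2 end.

Definition width_coef (d : R) (c : nat -> nat -> R) (N : nat)
    (i : 'I_1 + 'I_N * 'I_3) : R :=
  match i with inl _ => d | inr p => c p.1 p.2 end.

Lemma sum_width_family g N (d : R) (c : nat -> nat -> R) :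
  \sum_i width_coef d c i *: width_family (N := N) g i =
  d *: g + \sum_(i < N) \sum_(j < 3) c i j *: cell_L2 i j.
Proof.
by rewrite big_sumType/= big_ord1 pair_bigA/=; congr (_ + _); apply: eq_bigr => -[].
Qed.

Lemma burgers_manifold_approx (w : probability (measurableTypeR R) R) N v :
  (0 < N)%N -> burgers_manifold w v ->
  exists c, (L2_norm (v - \sum_i c i *: width_family (N := N) (icdf_L2 (-1) 4 w) i)%R
    <= (2 / N%:R ^+ 2 * Num.sqrt (2 / N%:R))%:E)%E.
Proof.
move=> N0 [t [y [ht [hy ->]]]].
(* The coefficient [-1] cancels the quantile function of [w]. *)
exists (@width_coef (- 1) (cell_coef N y t) N).
rewrite sum_width_family scaleN1r opprD opprK addrA subrK.
apply: (Lnorm_le_indic (A := `[y ^+ 2 * t / 2 - 2 / N%:R, y ^+ 2 * t / 2]%classic)).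
- exact: measurable_funP.
- exact: measurable_itv.
- by rewrite divr_ge0// sqr_ge0.
- by rewrite divr_ge0.
- by apply: lebesgue01_itv_le; rewrite divr_ge0.
apply: ae_lebesgue01 => s s01.
have [|k ck] := @ex_cell _ N s N0; first by case/andP: s01 => /ltW -> ->.
have /andP[t0 _] := ht; have /andP[yl _] := hy.
apply: le_trans (burgers_quantile_cell (ltn_ord k) yl t0 s01 ck).
rewrite L2_subE -(icdf_burgers ht hy s01) L2_sumE.
rewrite le_eqVlt; apply/orP; left; apply/eqP; congr (`|_ - _|).
rewrite -(sum_cell (fun i : 'I_N =>
  \sum_(j < 3) cell_coef N y t i j * Num.sqrt s ^+ j) ck).
apply: eq_bigr => i _; rewrite L2_sumE.
case: ifPn => ci; last first.
  by apply: big1 => j _; rewrite L2_scaleE cell_L2E /cell_monomial (negbTE ci) mulr0.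
by apply: eq_bigr => j _; rewrite L2_scaleE cell_L2E /cell_monomial ci.
Qed.

(** Meant for [n < 4], where [n %/ 4] leaves no cell; 5 is the uniform bound [|-1| + |4|] on
    quantile functions. *)
Lemma burgers_manifold_bound (w : probability (measurableTypeR R) R) N v :
  burgers_manifold w v ->
  exists c, (L2_norm (v - \sum_i c i *: width_family (N := N) (icdf_L2 (-1) 4 w) i)%R
    <= 5%:E)%E.
Proof.
move=> [t [y [ht [hy ->]]]].
exists (@width_coef (- 1) (fun _ _ => 0) N).
rewrite sum_width_family big1; last first.
  by move=> i _; rewrite big1// => j _; rewrite scale0r.
rewrite scaleN1r addr0 opprK subrK.
have -> : 5%:E = (5 * Num.sqrt 1)%:E :> \bar R by rewrite sqrtr1 mulr1.
apply: (@Lnorm_le_indic _ _ _ _ `[1 - 1, 1]%classic) => //.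
- exact: lebesgue01_itv_le.
apply: ae_lebesgue01 => s /andP[s0 s1].
rewrite indicE mem_set ?mulr1; last by rewrite /= in_itv/= subrr !ltW.
apply: le_trans (icdf_bounded _ _ _ _) _.
by rewrite normrN1 ger0_norm//; lra.
Qed.

(** From [n <= 8 * N] the error is at most [512 * n ^ (-5/2)], with [512 = 2 * 8 ^ 2 * 4]; the
    exponent is then weakened. *)
Lemma approximation_rate (n : nat) (N := (n %/ 4)%N) : (4 <= n)%N ->
  2 / N%:R ^+ 2 * Num.sqrt (2 / N%:R) <= 512 * n%:R `^ (- (21 / 10)) :> R.
Proof.
move=> n4.
have N0 : (0 < N)%N by rewrite divn_gt0.
have nN : (n <= 8 * N)%N.
  rewrite (divn_eq n 4) -/N; have : (n %% 4 < 4)%N by rewrite ltn_mod.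
  by move: N0; case: N => // m _; lia.
have n0 : 0 < n%:R :> R by rewrite ltr0n (leq_trans _ n4).
have N0' : 0 < N%:R :> R by rewrite ltr0n.
have Ni : N%:R^-1 <= 8 * n%:R^-1 :> R.
  rewrite -[leLHS]mul1r ler_pdivrMr// mulrAC ler_pdivlMr// mul1r.
  by rewrite -natrM ler_nat.
set u : R := n%:R^-1 in Ni *.
have u0 : 0 < u by rewrite invr_gt0.
have Ni0 : 0 < N%:R^-1 :> R by rewrite invr_gt0.
apply: (@le_trans _ _ ((2 * (8 * u) ^+ 2) * Num.sqrt (2 * (8 * u)))).
  apply: ler_pM; rewrite ?sqrtr_ge0 ?divr_ge0 ?sqr_ge0//.
    rewrite -exprVn ler_pM2l// lerXn2r// ?nnegrE ?ltW// mulr_gt0//.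
  by rewrite ler_sqrt ?ler_pM2l// ltW// !mulr_gt0.
have -> : Num.sqrt (2 * (8 * u)) = 4 * Num.sqrt u.
  have -> : 2 * (8 * u) = 4 ^+ 2 * u by ring.
  by rewrite sqrtrM ?sqr_ge0// sqrtr_sqr ger0_norm.
have -> : 2 * (8 * u) ^+ 2 * (4 * Num.sqrt u) = 512 * (u ^+ 2 * Num.sqrt u).
  by ring.
rewrite ler_pM2l//.
have -> : u ^+ 2 * Num.sqrt u = n%:R `^ (- (5 / 2)).
  rewrite -powR12_sqrt ?ltW// -powR_mulrn ?ltW// -powRD; last first.
    by apply/implyP; rewrite gt_eqF.
  rewrite /u -(powR_inv1 (ltW n0)) -powRrM; congr (_ `^ _); by field.
apply: ler_powR; first by rewrite ler1n (leq_trans _ n4).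
by lra.
Qed.

End burgers_approximation.

Theorem lemma3p2 (R : realType) (w : probability (measurableTypeR R) R)
    (w_supp : w `[-1, 4]%classic = 1%E)
    (w_mom2 : (\int[w]_x ((x : R) ^+ 2)%:E < +oo)%E) :
  exists C : R, 0 < C /\
    forall n : nat, (1 <= n)%N ->
      (kolmogorov_width (@L2_norm R) (burgers_manifold w) n
       <= (C * n%:R `^ (- (21 / 10)))%R%:E)%E.
Proof.
exists 512; split=> // n n1.
apply: (@kolmogorov_width_le _ _ (@L2_norm R) _ _ _ _ _ _ _
    (width_family (N := (n %/ 4)%N) (icdf_L2 (-1) 4 w))).
- by move=> u; exact: Lnorm_ge0.
- exact: L2_norm0.
- exact: L2_normD.
- by move=> a u; rewrite L2_normZ => ->; rewrite mule0.
- by move=> k; exists (fun i : 'I_k => cell_L2 i 0); exact: independent_cell_L2.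
(* [3 * (n %/ 4) + 1 <= n]; when the quotient is zero this is [1 <= n]. *)
- rewrite card_sum card_prod !card_ord.
  have := leq_trunc_div n 4; lia.
have [n4|n4] := leqP 4 n.
  move=> v /(@burgers_manifold_approx R w (n %/ 4)) [|c vc]; first by rewrite divn_gt0.
  exists c; apply: (le_trans vc); rewrite lee_fin; exact: approximation_rate.
move=> v /(@burgers_manifold_bound R w (n %/ 4))[c vc].
exists c; apply: (le_trans vc); rewrite lee_fin.
(* Here [n <= 3], so [512 / n ^ 3 >= 512 / 27 > 5]; the integer exponent [-3] is below [-21/10]. *)
apply: (@le_trans _ _ (512 * n%:R `^ (- 3%:R))); last first.
  by rewrite ler_pM2l//; apply: ler_powR; [rewrite ler1n|lra].
rewrite powRN powR_mulrn// ler_pdivlMr ?exprn_gt0 ?ltr0n//.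
have n3 : n%:R <= 3 :> R by rewrite (ler_nat _ n 3).
have : n%:R ^+ 3 <= 3 ^+ 3 :> R by rewrite lerXn2r// nnegrE.
lra.
Qed.
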